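(* Let $\tau>0$, let $n\ge 1$ be an integer, let $a=(a_0,\dots,a_n)\in\mathbb{R}^{n+1}$, and let $F_a(t)=\sum_{i=0}^n a_i\,\varphi_{i,n}(t/\tau)$ for $t\in[0,\tau]$. (i) (Monotone) If $a_0\le a_1\le\cdots\le a_n$, then $F_a'(t)\ge 0$ for every $t\in[0,\tau]$. (ii) (Unimodal concave) Let $n\ge 2$. If $a_1-a_0>0$, $a_n-a_{n-1}<0$, and $a_{i+1}+a_{i-1}\le 2a_i$ for every $i=1,\dots,n-1$, then $F_a'(0)>0$, $F_a'(\tau)<0$, and $F_a''(t)\le 0$ for every $t\in[0,\tau]$. (iii) (Unimodal) Let $n\ge 3$. Suppose that for some integers $0\le l_1<l_2<l_3\le n-1$ one has $a_0=a_1=\cdots=a_{l_1}<a_{l_1+1}\le a_{l_1+2}\le\cdots\le a_{l_2}$ and $a_{l_2}\ge a_{l_2+1}\ge\cdots\ge a_{l_3}>a_{l_3+1}=\cdots=a_n$. Then there exists $s\in(0,\tau)$ such that $s$ is the unique maximum point of $F_a$ on $[0,\tau]$, and $F_a$ is strictly increasing on $[0,s]$ and strictly decreasing on $[s,\tau]$. Furthermore, if $l_1>0$, then $F_a^{(i)}(0)=0$ for $i=1,\dots,l_1$; and if $l_3<n-1$, then $F_a^{(i)}(\tau)=0$ for $i=1,\dots,n-l_3-1$.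
   Context: For integers $0\le i\le n$, $\varphi_{i,n}(t)=\binom{n}{i}t^i(1-t)^{n-i}$ is the Bernstein basis polynomial. Derivatives at the endpoints $0$ and $\tau$ are one-sided; $F^{(i)}$ denotes the $i$-th derivative. *)

(* Defs.v *)
From HB Require Import structures.
From mathcomp Require Import all_boot all_order all_algebra.
From mathcomp Require Import all_classical all_reals all_analysis.

Set Implicit Arguments.
Unset Strict Implicit.
Unset Printing Implicit Defensive.

Import Order.TTheory GRing.Theory Num.Theory.
Import numFieldNormedType.Exports.

Local Open Scope classical_set_scope.
Local Open Scope ring_scope.

Definition bernstein (R : realType) (n i : nat) (t : R) : R :=
  'C(n, i)%:R * t ^+ i * (1 - t) ^+ (n - i).

Definition bernstein_comb (R : realType) (n : nat) (tau : R)
    (a : 'I_n.+1 -> R) (t : R) : R :=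
  \sum_(i < n.+1) a i * bernstein n i (t / tau).

(* Only the values of f on D enter: when D is a closed interval, the derivative
   is two-sided at interior points and one-sided at the endpoints. *)
Definition derivable_within (R : realType) (D : set R) (f : R -> R) (t : R) :=
  cvg ((f s - f t) / (s - t) @[s --> within D t^']).

Definition derive_within (R : realType) (D : set R) (f : R -> R) (t : R) : R :=
  lim ((f s - f t) / (s - t) @[s --> within D t^']).

Definition deriven_within (R : realType) (D : set R) (k : nat) (f : R -> R) :
  R -> R := iter k (derive_within D) f.

Section existence.
Variable R : realType.
Implicit Types (tau t : R) (f : R -> R) (p : {poly R}).

Let within_itv_proper tau t : 0 < tau -> t \in `[0, tau] ->
  ProperFilter (within `[0, tau] t^').
Proof.
move=> tau0; rewrite in_itv/= => /andP[t0 ttau].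
apply: Build_ProperFilter => /nbhs_ballP[e /= e0 sub].
have [tlt|tge] := ltP t tau.
- pose d := Num.min (e / 2) (tau - t).
  have d0 : 0 < d by rewrite lt_min divr_gt0//= subr_gt0.
  have de : d < e.
    by rewrite gt_min ltr_pdivrMr// ltr_pMr// ltr1n.
  apply: (sub (t + d)) => /=.
  + by rewrite /ball/= opprD addNKr normrN gtr0_norm.
  + by rewrite -subr_eq0 addrC addKr gt_eqF.
  + rewrite in_itv/= addr_ge0 ?(ltW d0)//= addrC -lerBrDr.
    by rewrite ge_min lexx orbT.
- have et : t = tau by apply/eqP; rewrite eq_le ttau.
  pose d := Num.min (e / 2) tau.
  have d0 : 0 < d by rewrite lt_min divr_gt0.
  have de : d < e.
    by rewrite gt_min ltr_pdivrMr// ltr_pMr// ltr1n.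
  apply: (sub (t - d)) => /=.
  + by rewrite /ball/= subKr gtr0_norm.
  + by rewrite -subr_eq0 addrC addKr oppr_eq0 gt_eqF.
  + rewrite in_itv/= et subr_ge0 ge_min lexx orbT/=.
    by rewrite gerBl ltW.
Qed.

Let quotient_cvg tau t f p : {in `[0, tau], f =1 horner p} ->
  t \in `[0, tau] ->
  (f s - f t) / (s - t) @[s --> within `[0, tau] t^'] --> p^`().[t].
Proof.
move=> fp tD.
have /factor_theorem[q pq] : root (p - p.[t]%:P) t.
  by rewrite rootE !hornerE subrr.
have -> : p^`().[t] = q.[t].
  have -> : p^`() = (p - p.[t]%:P)^`() by rewrite derivB derivC subr0.
  by rewrite pq derivM derivXsubC !hornerE subrr mulr0 add0r.
have qc : q.[s] @[s --> within `[0, tau] t^'] --> q.[t].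
  apply: (@cvg_trans _ (q.[s] @[s --> t])); last exact: continuous_horner.
  move=> A /= At; rewrite /nbhs/= /within/= /dnbhs /within/=.
  by apply: filterS At => x Ax _ _.
apply: cvg_trans qc; apply: near_eq_cvg.
rewrite near_withinE /dnbhs near_withinE.
apply: nearW => s st sD; rewrite !fp//.
have -> : p.[s] - p.[t] = (p - p.[t]%:P).[s] by rewrite !hornerE.
by rewrite pq !hornerE mulfK// subr_eq0.
Qed.

Let deriven_within_horner tau k f p : 0 < tau ->
  {in `[0, tau], f =1 horner p} ->
  {in `[0, tau], deriven_within `[0, tau] k f =1 horner p^`(k)}.
Proof.
move=> tau0 fp; elim: k => [|k IH] t tD; first by rewrite derivn0 -fp.
have FF := within_itv_proper tau0 tD.
by rewrite derivnS; apply/cvg_lim => //; exact: quotient_cvg.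
Qed.

Let bernstein_comb_horner n tau (a : 'I_n.+1 -> R) :
  exists p, bernstein_comb tau a =1 horner p.
Proof.
exists (\sum_(i < n.+1) (a i * 'C(n, i)%:R) *:
  ((tau^-1 *: 'X) ^+ i * (1 - tau^-1 *: 'X) ^+ (n - i))) => t.
rewrite /bernstein_comb horner_sum; apply: eq_bigr => i _.
by rewrite /bernstein !hornerE (mulrC tau^-1).
Qed.

(* The limits defining the derivatives of every order do exist. *)
Lemma bernstein_comb_smooth n tau (a : 'I_n.+1 -> R) k t :
  0 < tau -> t \in `[0, tau] ->
  derivable_within `[0, tau]
    (deriven_within `[0, tau] k (bernstein_comb tau a)) t.
Proof.
move=> tau0 tD; have [p Fp] := bernstein_comb_horner tau a.
apply/cvg_ex; exists (p^`(k)^`().[t]); apply: quotient_cvg => //.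
by apply: deriven_within_horner => // x _.
Qed.

End existence.

(* Main.v *)
(* Forward differences of the coefficients give the derivatives of a Bernstein
   polynomial, which settles (i), (ii) and the flatness at the endpoints in
   (iii).  For the unimodality, let d be the differences of a, with a single
   sign change at index k.  As phi_i(y) / phi_i(x) increases with i when x < y,
   each term satisfies d_i phi_i(y) <= (phi_k(y) / phi_k(x)) d_i phi_i(x), so
   once sum_i d_i phi_i is nonpositive it stays negative.  It is positive near
   0 and negative near 1, its lowest-order terms there being those of the
   extreme nonzero d_i, hence it has exactly one zero in (0, 1). *)
Require Import Defs.
From mathcomp Require Import all_boot all_order all_algebra.
From mathcomp Require Import all_classical all_reals all_analysis.
From mathcomp Require Import polyrcf ring lra zify.

Set Implicit Arguments.
Unset Strict Implicit.
Unset Printing Implicit Defensive.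

Import Order.TTheory GRing.Theory Num.Theory.
Import numFieldNormedType.Exports.

Local Open Scope classical_set_scope.
Local Open Scope ring_scope.

(** * Derivatives within an interval agree with formal derivatives of polynomials *)

Section derive_within_polynomial.
Variable R : realType.
Implicit Types (D : set R) (f : R -> R) (p : {poly R}).

(** No point of the interval is isolated: its points accumulate at [t] from the right if [t < tau],
    and from the left otherwise. Limits along this filter are therefore unique. *)
Lemma dnbhs_within_itv_proper (tau t : R) : 0 < tau -> 0 <= t <= tau ->
  ProperFilter (within `[0, tau] t^').
Proof.
move=> tau0 /andP[t0 ttau].
apply: Build_ProperFilter; rewrite /within /= => no_near.
have {}no_near : \forall s \near t, s != t -> ~ (0 <= s <= tau).
  by apply: (filterS _ no_near) => s; rewrite in_itv.
have [tlt|tge] := ltP t tau.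
- have [|s [sD ts st]] := @filter_ex _ (t^'+) _
      (fun s => [/\ ~ (0 <= s <= tau), t < s & s < tau]).
    near=> s; split; [|near: s|near: s];
      [|exact: nbhs_right_gt|exact: nbhs_right_lt].
    have ts : t < s by near: s; exact: nbhs_right_gt.
    move: (gt_eqF ts); near: s; apply: cvg_at_right_filter; [exact: cvg_id|].
    by apply: filterS no_near => s h st; apply: h; rewrite st.
  by apply: sD; rewrite (le_trans t0 (ltW ts)) ltW.
- have [|s [sD ts st]] := @filter_ex _ (t^'-) _
      (fun s => [/\ ~ (0 <= s <= tau), s < t & 0 < s]).
    have tpos : 0 < t by exact: lt_le_trans tge.
    near=> s; split; [|near: s|near: s];
      [|exact: nbhs_left_lt|exact: nbhs_left_gt].
    have ts : s < t by near: s; exact: nbhs_left_lt.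
    move: (lt_eqF ts); near: s; apply: cvg_at_left_filter; [exact: cvg_id|].
    by apply: filterS no_near => s h st; apply: h; rewrite st.
  by apply: sD; rewrite (ltW st) (le_trans (ltW ts)).
Unshelve. all: by end_near. Qed.

(** Writing [p - p.[t]] as [q * ('X - t)], the difference quotient equals [q] away from [t]. Hence
    its limit is [q.[t]], which is also the value of the formal derivative. *)
Lemma derive_within_horner D f p t : ProperFilter (within D t^') ->
  D t -> {in D, f =1 horner p} -> derive_within D f t = p^`().[t].
Proof.
move=> FF Dt fp; apply/cvg_lim => //.
have [q pq] : exists q, p - p.[t]%:P = q * ('X - t%:P).
  by apply/factor_theorem; rewrite rootE !hornerE subrr.
have pqs s : p.[s] - p.[t] = q.[s] * (s - t).
  by have := congr1 (horner^~ s) pq; rewrite !hornerE.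
have -> : p^`().[t] = q.[t].
  rewrite (_ : p^`() = (p - p.[t]%:P)^`()); last by rewrite derivB derivC subr0.
  by rewrite pq derivM derivXsubC !hornerE subrr mulr0 add0r.
have qc : q.[s] @[s --> within D t^'] --> q.[t].
  apply: cvg_trans (@continuous_horner R q t); apply: cvg_app.
  by apply: cvg_trans; [exact: cvg_within|exact: cvg_within].
apply: cvg_trans qc; apply: near_eq_cvg.
rewrite near_withinE /dnbhs near_withinE; apply: nearW => s st sD.
by rewrite !fp ?inE// pqs mulfK// subr_eq0.
Qed.

Lemma deriven_within_horner (tau : R) k f p : 0 < tau ->
  (forall t, 0 <= t <= tau -> f t = p.[t]) ->
  forall t, 0 <= t <= tau -> deriven_within `[0, tau] k f t = p^`(k).[t].
Proof.
move=> tau0 fp; elim: k => [|k IH] t tD; first by rewrite derivn0 -fp.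
rewrite derivnS; apply: derive_within_horner => [||s].
- exact: dnbhs_within_itv_proper.
- by rewrite /= in_itv.
- by rewrite inE /= in_itv; apply: IH.
Qed.

End derive_within_polynomial.

(** * Bernstein polynomials: derivatives by differences, signs and endpoint values *)

Section bernstein_polynomial.
Variable R : realType.
Implicit Types (c d : nat -> R) (x y : R).

(** Coefficients are indexed by [nat], so that shifts and differences keep the same type when the
    degree drops. *)
Definition bern n c : {poly R} :=
  \sum_(i < n.+1) (c i * 'C(n, i)%:R) *: ('X^i * (1 - 'X) ^+ (n - i)).

Definition fdiff c : nat -> R := fun i => c i.+1 - c i.

Lemma horner_bern n c x :
  (bern n c).[x] = \sum_(i < n.+1) c i * bernstein n i x.
Proof.
rewrite /bern horner_sum; apply: eq_bigr => i _.
by rewrite /bernstein !hornerE.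
Qed.

Lemma bernB n c d : bern n (fun i => c i - d i) = bern n c - bern n d.
Proof.
rewrite /bern -sumrB; apply: eq_bigr => i _.
by rewrite mulrBl scalerBl.
Qed.

(* One step of de Casteljau's algorithm. *)
Lemma bernS n c :
  bern n.+1 c = (1 - 'X) * bern n c + 'X * bern n (c \o succn).
Proof.
have -> : (1 - 'X) * bern n c = \sum_(i < n.+2)
    (c i * 'C(n, i)%:R) *: ('X^i * (1 - 'X) ^+ (n.+1 - i)).
  rewrite big_ord_recr /= bin_small// mulr0 scale0r addr0 mulr_sumr.
  apply: eq_bigr => i _; rewrite -scalerAr mulrCA -exprS subSn//.
  by rewrite -ltnS.
rewrite mulr_sumr /bern !(@big_ord_recl _ _ _ n.+1) /= !bin0 -addrA.
congr (_ + _); rewrite -big_split /=; apply: eq_bigr => i _.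
rewrite /bump /= !add1n binS natrD mulrDr scalerDl subSS.
by congr (_ + _); rewrite -scalerAr mulrA -exprS.
Qed.

Lemma bern0 c : bern 0 c = (c 0%N)%:P.
Proof. by rewrite /bern big_ord1 bin0 !expr0 !mulr1 alg_polyC. Qed.

(** Differentiating the de Casteljau step gives the step for [fdiff c], times the inductive factor,
    plus one more copy of the Bernstein polynomial of [fdiff c] from the weights [1 - 'X] and
    ['X]. *)
Lemma deriv_bern n c : (bern n.+1 c)^`() = n.+1%:R *: bern n (fdiff c).
Proof.
elim: n c => [|n IH] c.
  rewrite bernS !bern0 derivD !derivM derivB derivX !derivC scale1r polyCB.
  by rewrite /=; ring.
rewrite bernS derivD !derivM derivB derivX derivC !IH.
rewrite -[n.+2]add1n natrD scalerDl scale1r [X in _ = _ + _ *: X]bernS.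
rewrite [bern n.+1 (fdiff c)]bernB -!mul_polyC.
rewrite -[fdiff (c \o succn)]/(fdiff c \o succn).
ring.
Qed.

Lemma derivn_bern n k c : (k <= n)%N ->
  (bern n c)^`(k) = (n ^_ k)%:R *: bern (n - k) (iter k fdiff c).
Proof.
elim: k n c => [|k IH] n c; first by rewrite derivn0 subn0 scale1r.
case: n => // n kn; rewrite derivSn deriv_bern derivnZ IH// scalerA -natrM.
by rewrite ffactSS subSS iterSr.
Qed.

Lemma bernstein_ge0 n i x : 0 <= x <= 1 -> 0 <= bernstein n i x.
Proof.
move=> /andP[x0 x1]; rewrite /bernstein.
by rewrite !mulr_ge0 ?ler0n ?exprn_ge0// subr_ge0.
Qed.

Lemma bern_ge0 n c x : (forall i, (i <= n)%N -> 0 <= c i) ->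
  0 <= x <= 1 -> 0 <= (bern n c).[x].
Proof.
move=> c0 x01; rewrite horner_bern sumr_ge0// => i _.
by rewrite mulr_ge0 ?bernstein_ge0// c0// -ltnS.
Qed.

Lemma bern_le0 n c x : (forall i, (i <= n)%N -> c i <= 0) ->
  0 <= x <= 1 -> (bern n c).[x] <= 0.
Proof.
move=> c0 x01; rewrite horner_bern sumr_le0// => i _.
by rewrite mulr_le0_ge0 ?bernstein_ge0// c0// -ltnS.
Qed.

Lemma bern_at0 n c : (bern n c).[0] = c 0%N.
Proof.
rewrite horner_bern big_ord_recl big1 => [|i _].
  by rewrite /bernstein /= bin0 expr0 subr0 expr1n !mulr1 addr0.
by rewrite /bernstein /= expr0n /= mulr0 mul0r mulr0.
Qed.

(** This symmetry transfers statements from the endpoint 0 to the endpoint 1. *)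
Lemma bern_rev n c x :
  (bern n c).[1 - x] = (bern n (fun i => c (n - i)%N)).[x].
Proof.
rewrite !horner_bern (reindex_inj rev_ord_inj) /=; apply: eq_bigr => i _.
have ilt : (i <= n)%N by rewrite -ltnS.
by rewrite subSS /bernstein bin_sub// subKr subKn// mulrAC.
Qed.

Lemma bern_at1 n c : (bern n c).[1] = c n.
Proof. by rewrite -[1]subr0 bern_rev bern_at0 subn0. Qed.

(** * Sign changes and the single interior zero *)

(** The parenthesised factor is symmetric in [x] and [y], so exchanging them reduces to comparing
    [y * (1 - x)] with [x * (1 - y)]. *)
Lemma bernsteinM n i j x y : (i + j <= n)%N ->
  bernstein n i x * bernstein n (i + j) y =
  ('C(n, i)%:R * 'C(n, i + j)%:R * (x * y) ^+ i *
   ((1 - x) * (1 - y)) ^+ (n - (i + j))) * (y * (1 - x)) ^+ j.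
Proof.
move=> ijn; rewrite /bernstein (_ : n - i = n - (i + j) + j)%N; last lia.
by rewrite !exprMn !exprD; ring.
Qed.

(* bernstein n i y / bernstein n i x is increasing in i; cross-multiplied to
   avoid divisions. *)
Lemma bernstein_ratio_lt n i k x y : (i < k <= n)%N ->
  0 < x -> x < y -> y < 1 ->
  bernstein n i y * bernstein n k x < bernstein n i x * bernstein n k y.
Proof.
move=> /andP[ik kn] x0 xy y1.
have y0 : 0 < y by exact: lt_trans xy.
have x1 : x < 1 by exact: lt_trans y1.
rewrite -(subnKC (ltnW ik)) !bernsteinM ?subnKC ?(ltnW ik)//.
rewrite (mulrC y x) (mulrC (1 - y)) ltr_pM2l; last first.
  by rewrite !mulr_gt0 ?exprn_gt0 ?mulr_gt0 ?subr_gt0 ?ltr0n ?bin_gt0//; lia.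
rewrite ltrXn2r ?subn_eq0 -?ltnNge//= ?nnegrE ?mulr_ge0 ?subr_ge0 ?ltW//.
by rewrite !mulrBr !mulr1 (mulrC y) ltrD2r.
Qed.

Lemma bern_sign_change n k l d x y : (l < k <= n)%N ->
  (forall i, (i < k)%N -> 0 <= d i) -> 0 < d l ->
  (forall i, (k <= i <= n)%N -> d i <= 0) ->
  0 < x -> x < y -> y < 1 -> (bern n d).[x] <= 0 -> (bern n d).[y] < 0.
Proof.
move=> /andP[lk kn] dge0 dl dle0 x0 xy y1 bx0.
have y0 : 0 < y by exact: lt_trans xy.
have x1 : x < 1 by exact: lt_trans y1.
have phi_gt0 (z : R) : 0 < z -> z < 1 -> 0 < bernstein n k z.
  move=> z0 z1; rewrite /bernstein.
  by rewrite !mulr_gt0 ?exprn_gt0 ?subr_gt0 ?ltr0n ?bin_gt0.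
suff : bernstein n k x * (bern n d).[y] < bernstein n k y * (bern n d).[x].
  move=> /lt_le_trans/(_ (mulr_ge0_le0 (ltW (phi_gt0 _ y0 y1)) bx0)).
  by rewrite pmulr_rlt0// phi_gt0.
have ln : (l < n.+1)%N by lia.
have term i : (i < k)%N ->
    bernstein n i y * bernstein n k x < bernstein n i x * bernstein n k y.
  by move=> ik; apply: bernstein_ratio_lt => //; rewrite ik.
(* The sums are compared term by term; the term of index [l] is split off to provide strictness. *)
rewrite !horner_bern !mulr_sumr (bigD1 (Ordinal ln)) //=.
rewrite [ltRHS](bigD1 (Ordinal ln)) //=.
apply: ltr_leD.
  by rewrite !(mulrCA _ (d l)) ltr_pM2l// !(mulrC (bernstein n k _)) term.
apply: ler_sum => i _; rewrite !(mulrCA _ (d i)) !(mulrC (bernstein n k _)).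
(* Beyond [k] both the ratio inequality and the sign of [d i] are reversed; at [k] the two terms
   agree. *)
have [ik|ki|->] := ltngtP i k.
- by rewrite ler_wpM2l ?dge0// ltW// term.
- have i_n : (i <= n)%N by rewrite -ltnS.
  rewrite ler_wnM2l ?dle0 ?(ltnW ki)// ![bernstein n i _ * _]mulrC ltW//.
  by rewrite bernstein_ratio_lt// ki.
- by rewrite mulrC.
Qed.

(** Factoring out ['X^l] leaves a polynomial whose value at 0 is [d l * 'C(n, l)], which is
    positive; continuity keeps it positive just to the right of 0. *)
Lemma bern_gt0_near0 n l d : (l <= n)%N -> (forall i, (i < l)%N -> d i = 0) ->
  0 < d l -> exists2 x, 0 < x < 1 & 0 < (bern n d).[x].
Proof.
move=> ln d0 dl.
(* For [i < l] the truncated exponent [i - l] is 0, but the coefficient vanishes. *)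
pose q : {poly R} := \sum_(i < n.+1)
  (d i * 'C(n, i)%:R) *: ('X^(i - l) * (1 - 'X) ^+ (n - i)).
have bq : bern n d = 'X^l * q.
  rewrite mulr_sumr; apply: eq_bigr => i _; rewrite -scalerAr mulrA -exprD.
  have [il|li] := ltnP i l; first by rewrite d0// mul0r !scale0r.
  by rewrite subnKC.
have q0 : 0 < q.[0].
  have l_lt : (l < n.+1)%N by lia.
  rewrite horner_sum (bigD1 (Ordinal l_lt)) //= big1 => [|i il].
    rewrite hornerZ hornerM hornerXn subnn horner_exp hornerD hornerN hornerX.
    rewrite hornerC subr0 expr0 expr1n !mulr1 addr0.
    by rewrite mulr_gt0 ?ltr0n ?bin_gt0.
  have [il'|li] := ltnP i l; first by rewrite d0// mul0r scale0r horner0.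
  have {}il : (0 < i - l)%N by move: il; rewrite -val_eqE/=; lia.
  by rewrite hornerZ hornerM hornerXn expr0n eqn0Ngt il /= mul0r mulr0.
have [x [x0 x1 qx]] : exists x, [/\ 0 < x, x < 1 & 0 < q.[x]].
  apply: (@filter_ex _ (0^'+) _ (fun x : R => [/\ 0 < x, x < 1 & 0 < q.[x]])).
  near=> x; split; near: x; [exact: nbhs_right_gt|exact: nbhs_right_lt|].
  apply: cvgr_gt q0; apply: cvg_at_right_filter; exact: continuous_horner.
exists x; first by rewrite x0.
by rewrite bq !hornerE mulr_gt0// exprn_gt0.
Unshelve. all: by end_near. Qed.

Lemma bern_lt0_near1 n l d : (l <= n)%N ->
  (forall i, (l < i <= n)%N -> d i = 0) ->
  d l < 0 -> exists2 x, 0 < x < 1 & (bern n d).[x] < 0.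
Proof.
move=> ln d0 dl.
have [|i il||x /andP[x0 x1] bx] :=
    @bern_gt0_near0 n (n - l) (fun i => - d (n - i)%N).
- exact: leq_subr.
- by rewrite d0 ?oppr0//; lia.
- by rewrite subKn// oppr_gt0.
exists (1 - x); first by lra.
rewrite bern_rev -oppr_gt0; apply: lt_le_trans bx _.
rewrite !horner_bern -sumrN le_eqVlt; apply/orP; left; apply/eqP.
by apply: eq_bigr => i _; rewrite mulNr.
Qed.

(** The intermediate value theorem gives a zero [s]. Persistence of negativity makes the values
    after [s] negative, and a nonpositive value before [s] would make the value at [s] negative. *)
Lemma bern_single_root n k l m d : (l < k < m)%N -> (m <= n)%N ->
  (forall i, (i < l)%N -> d i = 0) -> 0 < d l ->
  (forall i, (i < k)%N -> 0 <= d i) ->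
  (forall i, (k <= i <= n)%N -> d i <= 0) ->
  d m < 0 -> (forall i, (m < i <= n)%N -> d i = 0) ->
  exists s, [/\ 0 < s < 1,
    forall x, 0 < x < s -> 0 < (bern n d).[x] &
    forall x, s < x < 1 -> (bern n d).[x] < 0].
Proof.
move=> /andP[lk km] mn d0l dl dge0 dle0 dm d0m.
have sgn x y : 0 < x -> x < y -> y < 1 ->
    (bern n d).[x] <= 0 -> (bern n d).[y] < 0.
  by apply: (@bern_sign_change _ k l) => //; lia.
have [|x /andP[x0 x1] bx] := @bern_gt0_near0 n l d _ d0l dl; first by lia.
have [y /andP[y0 y1] by_] := bern_lt0_near1 mn d0m dm.
(* Otherwise the negative value at [y] would persist up to [x]. *)
have xy : x < y.
  case: (ltgtP x y) => // [yx|E]; last by move: by_; rewrite -E ltNge ltW.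
  by have := sgn _ _ y0 yx x1 (ltW by_); rewrite ltNge ltW.
have [|s /[!in_itv]/= /andP[xs sy] /rootP bs] :=
    @poly_ivtoo _ (bern n d) _ _ (ltW xy).
  by rewrite pmulr_rlt0.
exists s; split=> [|z /andP[z0 zs]|z /andP[sz z1]].
- by rewrite (lt_trans x0)// (lt_trans sy).
- rewrite ltNge; apply/negP => bz.
  by have := sgn _ _ z0 zs (lt_trans sy y1) bz; rewrite bs ltxx.
- by apply: sgn (sz) _ _; rewrite ?bs// (lt_trans x0).
Qed.

(** The [k]-th difference at [i0] involves only the entries from [i0] to [i0 + k]. *)
Lemma iter_fdiff_eq0 k i0 c : (forall i, (i0 <= i <= i0 + k)%N -> c i = 0) ->
  iter k fdiff c i0 = 0.
Proof.
elim: k i0 => [|k IH] i0 c0; first by rewrite /= c0// addn0 leqnn.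
by rewrite iterS /fdiff !IH ?subrr// => i ik; apply: c0; lia.
Qed.

Lemma iter_fdiff_const k i0 c : (0 < k)%N ->
  (forall i, (i0 <= i < i0 + k)%N -> c i = c i.+1) -> iter k fdiff c i0 = 0.
Proof.
case: k => // k _ cE; rewrite iterSr; apply: iter_fdiff_eq0 => i ik.
by rewrite /fdiff -cE ?subrr//; lia.
Qed.

End bernstein_polynomial.

(** * Strict monotonicity from the sign of the derivative *)

Section strict_monotonicity.
Variable R : rcfType.
Implicit Type p : {poly R}.

(** The mean value theorem supplies an interior point, so the derivative may vanish at [a] and
    [b]. *)
Lemma horner_lt_increasing p a b : (forall x, a < x < b -> 0 < p^`().[x]) ->
  forall x y, a <= x -> x < y -> y <= b -> p.[x] < p.[y].
Proof.
move=> p'0 x y ax xy yb; have [z /[!in_itv]/= /andP[xz zy] E] := mvt p xy.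
rewrite -subr_gt0 E mulr_gt0 ?subr_gt0// p'0//.
by rewrite (le_lt_trans ax xz) (lt_le_trans zy yb).
Qed.

Lemma horner_lt_decreasing p a b : (forall x, a < x < b -> p^`().[x] < 0) ->
  forall x y, a <= x -> x < y -> y <= b -> p.[y] < p.[x].
Proof.
move=> p'0 x y ax xy yb; rewrite -ltrN2 -!hornerN.
apply: horner_lt_increasing ax xy yb => z /p'0.
by rewrite derivN hornerN oppr_gt0.
Qed.

End strict_monotonicity.

(** * Rescaling from the unit interval to [[0, tau]] *)

Section bernstein_comb.
Variables (R : realType) (tau : R) (n : nat) (a : 'I_n.+1 -> R).
Hypothesis tau_gt0 : 0 < tau.
Let c i := a (inord i).

Lemma bernstein_comb_bern t : bernstein_comb tau a t = (bern n c).[t / tau].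
Proof.
by rewrite horner_bern; apply: eq_bigr => i _; rewrite /c inord_val.
Qed.

(** Each differentiation contributes [tau^-1] by the chain rule and the current degree, whence the
    falling factorial. *)
Lemma deriven_bernstein_comb k t : (k <= n)%N -> 0 <= t <= tau ->
  deriven_within `[0, tau] k (bernstein_comb tau a) t =
  tau^-1 ^+ k * (n ^_ k)%:R * (bern (n - k) (iter k (@fdiff R) c)).[t / tau].
Proof.
move=> kn tD; pose p := bern n c \Po (tau^-1 *: 'X).
have pE j : p^`(j) = tau^-1 ^+ j *: ((bern n c)^`(j) \Po (tau^-1 *: 'X)).
  elim: j => [|j IH]; first by rewrite !derivn0 scale1r.
  rewrite !derivnS IH derivZ deriv_comp derivZ derivX alg_polyC.
  by rewrite mulrC mul_polyC scalerA -exprSr.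
rewrite (@deriven_within_horner _ _ _ _ p)// => [|u _].
  rewrite pE derivn_bern// hornerZ horner_comp !hornerZ hornerX mulrA.
  by rewrite (mulrC t).
by rewrite bernstein_comb_bern horner_comp hornerZ hornerX (mulrC u).
Qed.

Lemma deriven_bernstein_comb_scale k : (k <= n)%N ->
  0 < tau^-1 ^+ k * (n ^_ k)%:R.
Proof.
by move=> kn; rewrite mulr_gt0 ?exprn_gt0 ?invr_gt0// ltr0n ffact_gt0.
Qed.

End bernstein_comb.

Theorem proposition1 (R : realType) (tau : R) (n : nat) (a : 'I_n.+1 -> R)
    (tau_gt0 : 0 < tau) (n_ge1 : (1 <= n)%N) :
  let F := bernstein_comb tau a in
  let dF (k : nat) := deriven_within `[0, tau] k F in
  let a_ (i : nat) := a (inord i) in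
  [/\ (* (i) *)
      (forall i : nat, (i < n)%N -> a_ i <= a_ i.+1) ->
      (forall t : R, 0 <= t <= tau -> 0 <= dF 1%N t),
      (* (ii) *)
      (2 <= n)%N ->
      0 < a_ 1%N - a_ 0%N ->
      a_ n - a_ n.-1 < 0 ->
      (forall i : nat, (1 <= i <= n.-1)%N ->
         a_ i.+1 + a_ i.-1 <= 2 * a_ i) ->
      [/\ 0 < dF 1%N 0, dF 1%N tau < 0
        & forall t : R, 0 <= t <= tau -> dF 2%N t <= 0]
    & (* (iii) *)
      (3 <= n)%N ->
      forall l1 l2 l3 : nat,
      (l1 < l2)%N -> (l2 < l3)%N -> (l3 <= n.-1)%N ->
      (forall i : nat, (i < l1)%N -> a_ i = a_ i.+1) ->
      a_ l1 < a_ l1.+1 ->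
      (forall i : nat, (l1.+1 <= i < l2)%N -> a_ i <= a_ i.+1) ->
      (forall i : nat, (l2 <= i < l3)%N -> a_ i >= a_ i.+1) ->
      a_ l3 > a_ l3.+1 ->
      (forall i : nat, (l3.+1 <= i < n)%N -> a_ i = a_ i.+1) ->
      [/\ exists s : R,
            [/\ 0 < s < tau,
                forall t : R, 0 <= t <= tau -> F t <= F s,
                forall t : R, 0 <= t <= tau ->
                  (forall u : R, 0 <= u <= tau -> F u <= F t) -> t = s,
                forall x y : R, 0 <= x -> x < y -> y <= s -> F x < F y
              & forall x y : R, s <= x -> x < y -> y <= tau -> F y < F x],
          (0 < l1)%N ->
            forall i : nat, (1 <= i <= l1)%N -> dF i 0 = 0
        & (l3 < n.-1)%N ->
            forall i : nat, (1 <= i <= n - l3 - 1)%N -> dF i tau = 0]].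
Proof.
move=> F dF a_.
have itv01 t : 0 <= t <= tau -> 0 <= t / tau <= 1.
  move=> /andP[t0 tt].
  by rewrite divr_ge0 ?(ltW tau_gt0)//= ler_pdivrMr// mul1r.
(* Only signs and zeros of derivatives matter below, so the positive scale stays abstract. *)
have dFE k t : (k <= n)%N -> 0 <= t <= tau ->
    exists2 r : R, 0 < r &
      dF k t = r * (bern (n - k) (iter k (@fdiff R) a_)).[t / tau].
  move=> kn tD; exists (tau^-1 ^+ k * (n ^_ k)%:R).
    exact: deriven_bernstein_comb_scale.
  exact: deriven_bernstein_comb.
have at0 : 0 <= (0 : R) <= tau by rewrite lexx ltW.
have attau : 0 <= tau <= tau by rewrite lexx ltW.
split.
- move=> a_nd t tD; have [r r0 ->] := dFE 1%N t n_ge1 tD.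
  rewrite mulr_ge0 ?(ltW r0)// bern_ge0 ?itv01// => i i_n.
  by rewrite /= /fdiff subr_ge0 a_nd//; lia.
- move=> n2 a01 an a_cc; split.
  + have [r r0 ->] := dFE 1%N 0 n_ge1 at0.
    by rewrite mul0r bern_at0 mulr_gt0.
  + have [r r0 ->] := dFE 1%N tau n_ge1 attau.
    rewrite divff ?gt_eqF// bern_at1 pmulr_rlt0//= /fdiff subn1.
    by rewrite prednK.
  + move=> t tD; have [r r0 ->] := dFE 2%N t n2 tD.
    rewrite pmulr_rle0// bern_le0 ?itv01// => i i_n.
    (* The second difference at [i] is centred at [i.+1]. *)
    have /a_cc : (1 <= i.+1 <= n.-1)%N by lia.
    by rewrite /= /fdiff; lra.
move=> n3 l1 l2 l3 l12 l23 l3n a_l1 al1 a_l2 a_l3 al3 a_n; split.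
- have fd0 i : a_ i = a_ i.+1 -> fdiff a_ i = 0.
    by rewrite /fdiff => ->; rewrite subrr.
  (* The differences change sign at [l2]; the first nonzero one has index [l1], the last has index
     [l3]. *)
  have [|||||||i|s [/andP[s0 s1] bpos bneg]] :=
      @bern_single_root R n.-1 l2 l1 l3 (fdiff a_).
  + by rewrite l12.
  + exact: l3n.
  + by move=> i il; rewrite fd0// a_l1.
  + by rewrite subr_gt0.
  + move=> i il2; have [il1|l1i|->] := ltngtP i l1.
    * by rewrite fd0// a_l1.
    * by rewrite subr_ge0 a_l2// il2 andbT.
    * by rewrite subr_ge0 ltW.
  + move=> i /andP[l2i i_n]; have [il3|l3i|->] := ltngtP i l3.
    * by rewrite subr_le0 a_l3// l2i.
    * by rewrite fd0// a_n//; lia.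
    * by rewrite subr_le0 ltW.
  + by rewrite subr_lt0.
  + by move=> i_n; rewrite fd0// a_n//; lia.
  have dE x : (bern n a_)^`().[x] = n%:R * (bern n.-1 (fdiff a_)).[x].
    by rewrite -[in LHS](prednK n_ge1) deriv_bern hornerZ prednK.
  have incr x y : 0 <= x -> x < y -> y <= s * tau -> F x < F y.
    move=> x0 xy ys; rewrite /F !bernstein_comb_bern.
    apply: (@horner_lt_increasing _ _ 0 s) => [z zs|||].
    - by rewrite dE mulr_gt0 ?ltr0n ?bpos.
    - by rewrite divr_ge0// ltW.
    - by rewrite ltr_pM2r ?invr_gt0.
    - by rewrite ler_pdivrMr.
  have decr x y : s * tau <= x -> x < y -> y <= tau -> F y < F x.
    move=> sx xy y1; rewrite /F !bernstein_comb_bern.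
    apply: (@horner_lt_decreasing _ _ s 1) => [z zs|||].
    - by rewrite dE pmulr_rlt0 ?ltr0n ?bneg.
    - by rewrite ler_pdivlMr.
    - by rewrite ltr_pM2r ?invr_gt0.
    - by rewrite ler_pdivrMr// mul1r.
  have st0 : 0 < s * tau by rewrite mulr_gt0.
  have st1 : s * tau < tau by rewrite gtr_pMl.
  (* Strictness here yields both maximality and uniqueness of [s * tau]. *)
  have maxlt t : 0 <= t <= tau -> t != s * tau -> F t < F (s * tau).
    move=> /andP[t0 tt]; rewrite neq_lt => /orP[ts|st]; first exact: incr.
    exact: decr.
  exists (s * tau); split=> //.
  + by rewrite st0.
  + move=> t tD; have [->//|ts] := eqVneq t (s * tau).
    by rewrite ltW// maxlt.
  + move=> t tD tmax; apply/eqP/negPn/negP => /(maxlt t tD).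
    by rewrite ltNge tmax// !ltW.
(* At 0 the derivative is a multiple of the [i]-th difference at index 0, which sees only the equal
   entries up to [l1]. *)
- move=> _ i /andP[i0 il1].
  have [|r _ ->] := dFE i 0 _ at0; first by lia.
  rewrite mul0r bern_at0 iter_fdiff_const ?mulr0// => j ji.
  by rewrite a_l1//; lia.
(* At [tau] the difference starts at index [n - i], which is at least [l3.+1], inside the final
   constant block. *)
- move=> _ i /andP[i0 il3].
  have [|r _ ->] := dFE i tau _ attau; first by lia.
  rewrite divff ?gt_eqF// bern_at1 iter_fdiff_const ?mulr0// => j ji.
  by rewrite a_n//; lia.
Qed.
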